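(* Let $n\ge 1$, $\mathcal I=\{1,\dots,n\}$, let $\mathcal X,\mathcal W$ and $\mathcal Y_i$ ($i\in\mathcal I$) be finite nonempty sets and $g:\mathcal W\times\mathcal X\to[0,1]$ a gain function. For any prior $\pi$ on $\mathcal X$ with $V_g(\pi)>0$ and any channels $(\mathcal X,\mathcal Y_i,C_i)$, $i\in\mathcal I$, $$I_g\bigl(\pi,\ \parallel_{i\in\mathcal I}C_i\bigr)\ \le\ \sum_{i\in\mathcal I}I_g(\pi,C_i)+(\#\mathcal I-1)\cdot\bigl(H_g^{\min}(\pi)-H_g(\pi)\bigr).$$
   Context: A (discrete) channel $(\mathcal X,\mathcal Y,C)$ consists of finite sets $\mathcal X,\mathcal Y$ and a matrix $C$ with entries $C[x,y]\ge 0$ and $\sum_{y}C[x,y]=1$ for each $x$. A prior on $\mathcal X$ is a probability distribution on $\mathcal X$. The $n$-ary parallel composition with shared input $\parallel_{i\in\mathcal I}C_i=C_1\parallel\cdots\parallel C_n$ is the channel from $\mathcal X$ to $\mathcal Y_1\times\cdots\times\mathcal Y_n$ whose entry at $(x,(y_1,\dots,y_n))$ is $\prod_i C_i[x,y_i]$. $V_g(\pi)=\max_{w\in\mathcal W}\sum_{x}\pi[x]g(w,x)$, $V_g(\pi,C)=\sum_{y}\max_{w\in\mathcal W}\sum_x\pi[x]C[x,y]g(w,x)$, $H_g(\pi)=-\log V_g(\pi)$, $H_g(\pi,C)=-\log V_g(\pi,C)$, and the $g$-leakage is $I_g(\pi,C)=H_g(\pi)-H_g(\pi,C)$. Logarithms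 are to base 2. $H_g^{\min}(\pi)=-\log\min\{\pi[x]g(w,x): x\in\mathcal X,\ w\in\mathcal W,\ \pi[x]g(w,x)\ne0\}$. *)

(* Defs.v *)
From mathcomp Require Import all_boot all_order all_algebra.
From mathcomp Require Import reals exp.

Set Implicit Arguments.
Unset Strict Implicit.
Unset Printing Implicit Defensive.

Import Order.TTheory GRing.Theory Num.Theory.

Local Open Scope ring_scope.

Record prior (R : realType) (X : finType) := Prior {
  prior_fun :> X -> R;
  prior_ge0 : forall x, 0 <= prior_fun x;
  prior_sum1 : \sum_x prior_fun x = 1 }.

Record channel (R : realType) (X Y : finType) := Channel {
  channel_fun :> X -> Y -> R;
  channel_ge0 : forall x y, 0 <= channel_fun x y;
  channel_sum1 : forall x, \sum_y channel_fun x y = 1 }.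

Record gain (R : realType) (W X : finType) := Gain {
  gain_fun :> W -> X -> R;
  gain_ge0 : forall w x, 0 <= gain_fun w x;
  gain_le1 : forall w x, gain_fun w x <= 1 }.

Definition par_fun (R : realType) (X : finType) (n : nat) (Y : 'I_n -> finType)
    (C : forall i, channel R X (Y i)) (x : X) (y : {dffun forall i, Y i}) : R :=
  \prod_(i < n) C i x (y i).

Lemma par_fun_ge0 (R : realType) (X : finType) (n : nat) (Y : 'I_n -> finType)
    (C : forall i, channel R X (Y i)) x y : 0 <= par_fun C x y.
Proof. by apply: prodr_ge0 => i _; exact: channel_ge0. Qed.

Lemma par_fun_sum1 (R : realType) (X : finType) (n : nat) (Y : 'I_n -> finType)
    (C : forall i, channel R X (Y i)) x : \sum_y par_fun C x y = 1.
Proof.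
rewrite (reindex (@dffun_of_fprod _ Y)) /=; last first.
  exact/onW_bij/dffun_of_fprod_bij.
pose P i : {ffun Y i -> R} := [ffun j => C i x j].
transitivity (\sum_(t : fprod Y) \prod_(i in 'I_n) P i (t i)).
  by apply: eq_bigr => t _; apply: eq_bigr => i _; rewrite !ffunE.
rewrite big_fprod -(bigA_distr_big_dep (fun i => tagged_with Y i)
  (fun i u => untag 0 (P i) u)).
apply: big1 => i _; rewrite -(channel_sum1 (C i) x) -(big_tag P).
by apply: eq_bigr => j _; rewrite ffunE.
Qed.

Definition parallel (R : realType) (X : finType) (n : nat)
    (Y : 'I_n -> finType) (C : forall i, channel R X (Y i)) :
    channel R X {dffun forall i, Y i} :=
  Channel (par_fun_ge0 C) (par_fun_sum1 C).

Definition log2 (R : realType) (x : R) : R := ln x / ln 2.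

(* All the values under the maxima below are nonnegative, so over a nonempty
   [W] the default value 0 of the big operator does not affect the maximum. *)
Definition Vg (R : realType) (W X : finType) (g : gain R W X)
    (pi : prior R X) : R :=
  \big[Num.max/0]_(w : W) \sum_(x : X) pi x * g w x.

Definition Vg_post (R : realType) (W X Y : finType) (g : gain R W X)
    (pi : prior R X) (C : channel R X Y) : R :=
  \sum_(y : Y) \big[Num.max/0]_(w : W) \sum_(x : X) pi x * C x y * g w x.

Definition Hg (R : realType) (W X : finType) (g : gain R W X)
    (pi : prior R X) : R := - log2 (Vg g pi).

Definition Hg_post (R : realType) (W X Y : finType) (g : gain R W X)
    (pi : prior R X) (C : channel R X Y) : R := - log2 (Vg_post g pi C).

Definition Ig (R : realType) (W X Y : finType) (g : gain R W X)
    (pi : prior R X) (C : channel R X Y) : R := Hg g pi - Hg_post g pi C.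

(* All the products [pi x * g w x] are at most 1, so the default value 1 does
   not affect the minimum as long as one of them is nonzero, which is the case
   when [0 < Vg g pi]. *)
Definition min_gain (R : realType) (W X : finType) (g : gain R W X)
    (pi : prior R X) : R :=
  \big[Num.min/1]_(p : X * W | pi p.1 * g p.2 p.1 != 0) (pi p.1 * g p.2 p.1).

Definition Hg_min (R : realType) (W X : finType) (g : gain R W X)
    (pi : prior R X) : R := - log2 (min_gain g pi).

(* Main.v *)
Require Import Defs.
From mathcomp Require Import all_boot all_order all_algebra.
From mathcomp Require Import reals exp.
From mathcomp Require Import ring.

(** Write [V], [V_i], [V_par] for the prior and posterior vulnerabilities and
    [m] for the least nonzero value of [pi x * g w x]. Exponentiating, the claim
    is [m ^+ (n - 1) * V_par <= \prod_i V_i]. Expanding the product on the right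
    over all tuples [y], it suffices to prove this for each [y] and each [w],
    where it reads, with [a x = pi x * g w x] and [c i x = C i x (y i)],
    [m ^+ (n - 1) * \sum_x a x * \prod_i c i x <= \prod_i \sum_x a x * c i x].
    The right-hand side dominates its diagonal part
    [\sum_x a x ^+ n * \prod_i c i x], and each [a x] is [0] or at least [m]. *)

Import Order.TTheory GRing.Theory Num.Theory.

Local Open Scope ring_scope.

(** Distributivity when the range [Y i] varies with [i]: through [fprod], tuples become plain
    functions into a tagged union, where the non-dependent law applies. *)
Lemma prod_sum_dffun {R : comPzSemiRingType} {I : finType} {Y : I -> finType}
    (F : forall i, Y i -> R) :
  \prod_i \sum_j F i j = \sum_(y : {dffun forall i, Y i}) \prod_i F i (y i).
Proof.
rewrite [RHS](reindex (@dffun_of_fprod _ Y)) /=; last first.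
  exact/onW_bij/dffun_of_fprod_bij.
pose P i : {ffun Y i -> R} := [ffun j => F i j].
transitivity (\sum_(t : fprod Y) \prod_(i in I) P i (t i)); last first.
  by apply: eq_bigr => t _; apply: eq_bigr => i _; rewrite !ffunE.
rewrite big_fprod -(bigA_distr_big_dep (fun i => tagged_with Y i)
  (fun i u => untag 0 (P i) u)).
apply: eq_bigr => i _; rewrite -(big_tag P).
by apply: eq_bigr => j _; rewrite ffunE.
Qed.

(** The left side is the diagonal of the expanded product. At least one factor is required: empty
    products would give [#|X| <= 1]. *)
Lemma ler_sum_prod {R : numDomainType} {X : finType} {n : nat}
    (F : 'I_n.+1 -> X -> R) :
  (forall i x, 0 <= F i x) -> \sum_x \prod_i F i x <= \prod_i \sum_x F i x.
Proof.
elim: n F => [|n IHn] F F0.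
  by rewrite big_ord1; under eq_bigr do rewrite big_ord1.
rewrite big_ord_recl; under eq_bigr do rewrite big_ord_recl.
apply: (@le_trans _ _ ((\sum_x F ord0 x) *
                       \sum_x \prod_(i < n.+1) F (lift ord0 i) x)); last first.
  by apply: ler_wpM2l; [exact: sumr_ge0 | exact: IHn].
rewrite mulr_sumr; apply: ler_sum => x _; apply: ler_wpM2r.
  by apply: prodr_ge0 => i _; exact: F0.
by rewrite (bigD1 x) //= lerDl; apply: sumr_ge0.
Qed.

Lemma ln_prod_gt0 {R : realType} {n : nat} (F : 'I_n -> R) :
  (forall i, 0 < F i) -> ln (\prod_i F i) = \sum_i ln (F i).
Proof.
(* Positivity is carried through the induction, since [lnM] needs it. *)
move=> F0; suff [] : 0 < \prod_i F i /\ ln (\prod_i F i) = \sum_i ln (F i).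
  by [].
elim/big_rec2: _ => [|i p s _ [p0 <-]]; first by rewrite ln1.
by split; rewrite ?lnM ?mulr_gt0 ?posrE.
Qed.

Lemma min_gain_gt0 {R : realType} {W X : finType} (g : gain R W X)
    (pi : prior R X) : 0 < min_gain g pi.
Proof.
rewrite /min_gain; elim/big_ind: _ => // [a b a0 b0|p pN0].
  by rewrite lt_min a0.
by rewrite lt_def pN0 mulr_ge0 ?prior_ge0 ?gain_ge0.
Qed.

Lemma min_gain_le {R : realType} {W X : finType} (g : gain R W X)
    (pi : prior R X) x w :
  pi x * g w x != 0 -> min_gain g pi <= pi x * g w x.
Proof.
move=> xwN0.
exact: (bigmin_le_cond 1 (j := (x, w)) (fun p => pi p.1 * g p.2 p.1)).
Qed.

(** A maximum of sums is at most the sum of the maxima. This makes every posterior vulnerability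
    positive, so that its logarithm is meaningful. *)
Lemma Vg_le_post {R : realType} {W X Y : finType} (g : gain R W X)
    (pi : prior R X) (C : channel R X Y) : Vg g pi <= Vg_post g pi C.
Proof.
apply: bigmax_le => [|w _].
  by apply: sumr_ge0 => y _; exact: bigmax_ge_id.
have -> : \sum_x pi x * g w x = \sum_y \sum_x pi x * C x y * g w x.
  rewrite exchange_big; apply: eq_bigr => x _.
  by rewrite -mulr_suml -mulr_sumr channel_sum1 mulr1.
apply: ler_sum => y _.
exact: (le_bigmax _ (fun w => \sum_x pi x * C x y * g w x)).
Qed.

Lemma Vg_post_parallel_le {R : realType} {n : nat} {X W : finType}
    {Y : 'I_n.+1 -> finType} (g : gain R W X) (pi : prior R X)
    (C : forall i, channel R X (Y i)) :
  min_gain g pi ^+ n * Vg_post g pi (parallel C) <=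
    \prod_i Vg_post g pi (C i).
Proof.
have m_gt0 := min_gain_gt0 g pi.
have m_ge0 := ltW m_gt0.
rewrite /Vg_post prod_sum_dffun mulr_sumr; apply: ler_sum => y _.
(* Dividing by the power of [min_gain] isolates the maximum, to be bounded for each [w] and for the
   default 0. *)
rewrite -ler_pdivlMl ?exprn_gt0 //; apply: bigmax_le => [|w _].
  by rewrite mulr_ge0 ?invr_ge0 ?exprn_ge0 ?prodr_ge0 // => i _;
    exact: bigmax_ge_id.
rewrite ler_pdivlMl ?exprn_gt0 //.
have F0 i x : 0 <= pi x * C i x (y i) * g w x.
  by rewrite !mulr_ge0 ?prior_ge0 ?channel_ge0 ?gain_ge0.
(* Each maximum on the right is bounded below by its value at the same [w]. *)
apply: (@le_trans _ _ (\prod_i \sum_x pi x * C i x (y i) * g w x)); last first.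
  apply: ler_prod => i _; rewrite sumr_ge0 //=.
  exact: (le_bigmax _ (fun w => \sum_x pi x * C i x (y i) * g w x)).
apply: le_trans (ler_sum_prod _ F0).
rewrite mulr_sumr; apply: ler_sum => x _.
have -> : \prod_i (pi x * C i x (y i) * g w x) =
          (pi x * g w x) ^+ n * (pi x * g w x * par_fun C x y).
  rewrite mulrA -exprSr /par_fun -[in X in _ ^+ X](card_ord n.+1).
  by rewrite -prodr_const -big_split; apply: eq_bigr => i _; rewrite mulrAC.
rewrite /= [pi x * _ * _]mulrAC.
have [->|xwN0] := eqVneq (pi x * g w x) 0; first by rewrite !mul0r !mulr0.
apply: ler_wpM2r.
  by rewrite !mulr_ge0 ?prior_ge0 ?gain_ge0 ?par_fun_ge0.
by rewrite lerXn2r ?nnegrE ?min_gain_le ?mulr_ge0 ?prior_ge0 ?gain_ge0.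
Qed.

Theorem proposition3p18 (R : realType) (n : nat) (hn : (1 <= n)%N)
    (X W : finType) (Y : 'I_n -> finType)
    (hX : (0 < #|X|)%N) (hW : (0 < #|W|)%N) (hY : forall i, (0 < #|Y i|)%N)
    (g : gain R W X) (pi : prior R X) (hV : 0 < Vg g pi)
    (C : forall i, channel R X (Y i)) :
  Ig g pi (parallel C) <=
    \sum_(i < n) Ig g pi (C i) + (n%:R - 1) * (Hg_min g pi - Hg g pi).
Proof.
(* From here [n] stands for the number of channels minus one. *)
case: n hn Y hY C => // n _ Y _ C.
have post_gt0 Z (D : channel R X Z) : 0 < Vg_post g pi D.
  exact: lt_le_trans hV (Vg_le_post g pi D).
have m_gt0 := min_gain_gt0 g pi.
have : n%:R * ln (min_gain g pi) + ln (Vg_post g pi (parallel C)) <=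
       \sum_i ln (Vg_post g pi (C i)).
  rewrite -ln_prod_gt0 // mulr_natl -lnXn // -lnM ?posrE ?exprn_gt0 //.
  by rewrite ler_ln ?posrE ?mulr_gt0 ?exprn_gt0 ?prodr_gt0 ?Vg_post_parallel_le.
have ln2V_gt0 : 0 < (ln (2 : R))^-1 by rewrite invr_gt0 ln_gt0 ?ltr1n.
rewrite -(ler_pM2r ln2V_gt0) => le_log.
have -> : \sum_i Ig g pi (C i) =
    (\sum_i ln (Vg_post g pi (C i))) / ln 2 - n.+1%:R * log2 (Vg g pi).
  rewrite mulr_suml mulr_natl -[in X in _ - _ *+ X](card_ord n.+1).
  rewrite -sumr_const -sumrB; apply: eq_bigr => i _.
  by rewrite /Ig /Hg /Hg_post opprK addrC.
(* Of the [n.+1] copies of [log2 (Vg g pi)], [n] cancel against those from [Hg g pi], so both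
   differences agree. *)
rewrite -subr_ge0 in le_log; rewrite -subr_ge0.
rewrite /Ig /Hg /Hg_post /Hg_min /log2 -natr1; congr (0 <= _): le_log; ring.
Qed.
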